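(* For every accuracy $\delta\in(0,1]$ (in particular for arbitrarily small $\delta>0$), there is no online algorithm for Online Bin Packing with Estimated Item Sizes with accuracy $\delta$ that is $c$-competitive for some $c<\frac{4}{3}$.
   Context: Online Bin Packing with Estimated Item Sizes: an input is a list $L=a_1,\dots,a_n$ of items. Before any item is revealed, the algorithm receives the accuracy $\delta\in(0,1]$ and an estimated size $c'(a)\in(0,1]$ for every item $a\in L$ (so in particular it knows $n$). The items are then revealed one by one together with their actual sizes $c(a)$, where $c(a)\in[c'(a)(1-\delta),\min(c'(a)(1+\delta),1)]$; each item must be irrevocably assigned to a bin (of capacity $1$; the total size of items in a bin may not exceed $1$) before the next item is revealed. The goal is to minimize the number of bins used. $A(L)$ denotes the number of bins used by algorithm $A$ on $L$ and $OPT(L)$ the minimum number of bins in any packing of $L$. An algorithm $A$ is $c$-competitive if there is a constant $K$ such that $A(L)\le c\cdot OPT(L)+K$ for every input list $L$ (and every admissible choice of estimates and actual sizes). *)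

(* Defs.v *)
From mathcomp Require Import all_boot all_order all_algebra.
From mathcomp Require Import reals.

Set Implicit Arguments.
Unset Strict Implicit.
Unset Printing Implicit Defensive.
Import Order.TTheory GRing.Theory Num.Theory.
Local Open Scope ring_scope.

(* Input lists with n items are given by two n-tuples: the estimates [e] and
   the actual sizes [s], in the order in which the items are revealed. *)
Definition admissible (R : realType) (delta : R) (n : nat)
    (e s : n.-tuple R) : Prop :=
  forall i : 'I_n,
    (0 < tnth e i <= 1) /\
    (tnth e i * (1 - delta) <= tnth s i
       <= Num.min (tnth e i * (1 + delta)) 1).

(* An assignment of the n items to bins with labels in T. Bins that receive
   no item are not constrained and not counted. *)
Definition is_packing (R : realType) (n : nat) (T : eqType)
    (s : n.-tuple R) (p : 'I_n -> T) : bool :=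
  [forall i : 'I_n, \sum_(j < n | p j == p i) tnth s j <= 1].

Definition nbins (n : nat) (T : eqType) (p : 'I_n -> T) : nat :=
  size (undup (codom p)).

(* n labels suffice to pack n items. The starting point of the minimization,
   one bin per item, is a packing as soon as all sizes are at most 1. *)
Definition OPT (R : realType) (n : nat) (s : n.-tuple R) : nat :=
  nbins [arg min_(p < [ffun i => i] : {ffun 'I_n -> 'I_n} | is_packing s p)
           nbins p].

(* [A delta e h] is the bin chosen for the item revealed last, where [e] lists
   the estimates of all the items and [h] the actual sizes revealed so far,
   that of the current item included. Earlier decisions of the (deterministic)
   algorithm are determined by the prefixes of [h]. *)
Definition online_algorithm (R : realType) : Type :=
  R -> seq R -> seq R -> nat.

Definition run (R : realType) (A : online_algorithm R) (delta : R) (n : nat)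
    (e s : n.-tuple R) : 'I_n -> nat :=
  fun i => A delta e (take i.+1 s).

Definition respects_capacity (R : realType) (A : online_algorithm R)
    (delta : R) : Prop :=
  forall (n : nat) (e s : n.-tuple R),
    admissible delta e s -> is_packing s (run A delta e s).

Definition competitive (R : realType) (A : online_algorithm R)
    (delta c : R) : Prop :=
  exists K : R, forall (n : nat) (e s : n.-tuple R),
    admissible delta e s ->
    (nbins (run A delta e s))%:R <= c * (OPT s)%:R + K.

(* Main.v *)
(* All estimates are 1/2. The adversary first bisects an interval [l, u] just
   below 1/2, presenting its midpoint x: it continues with [l, x] if x opens a
   new bin and with [x, u] otherwise. So after k items, a of which opened a bin,
   the openers have size at least u and the k - a others at most l. It stops as
   soon as k - a equals the number M of remaining items (up to 1), and gives
   these size 1 - l. They fit neither with one another nor with an opener, so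
   the algorithm uses a + M bins, whereas an optimal packing pairs them with the
   small items and pairs the openers, using about M + a/2 bins. Since no three
   items share a bin, M is about k - a <= a and the ratio is at least 4/3. *)

Require Import Defs.
From mathcomp Require Import all_boot all_order all_algebra.
From mathcomp Require Import reals.
From mathcomp Require Import zify lra.

Set Implicit Arguments.
Unset Strict Implicit.
Unset Printing Implicit Defensive.
Import Order.TTheory GRing.Theory Num.Theory.
Local Open Scope ring_scope.

(** * Decision sequences along a history *)

(** A list version of [run], meaningful for a history still under construction, before the full
    tuple of sizes exists. *)
Definition labels (R : realType) (f : seq R -> nat) (h : seq R) : seq nat :=
  [seq f (take i.+1 h) | i <- iota 0 (size h)].

Lemma size_labels (R : realType) (f : seq R -> nat) (h : seq R) :
  size (labels f h) = size h.
Proof. by rewrite size_map size_iota. Qed.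

Lemma nth_labels (R : realType) (f : seq R -> nat) (h : seq R) (i : nat) :
  (i < size h)%N -> nth 0%N (labels f h) i = f (take i.+1 h).
Proof.
move=> ih; rewrite (nth_map 0%N) ?size_iota //.
by rewrite nth_iota.
Qed.

(** Being online enters here: each label depends only on a prefix, so the decisions on [h] survive
    every continuation [t]. *)
Lemma labels_cat (R : realType) (f : seq R -> nat) (h t : seq R) :
  exists2 w, labels f (h ++ t) = labels f h ++ w & size w = size t.
Proof.
exists (drop (size h) (labels f (h ++ t))); last first.
  by rewrite size_drop size_labels size_cat addKn.
rewrite -[LHS](cat_take_drop (size h)); congr (_ ++ _).
rewrite -map_take take_iota size_cat.
have -> : minn (size h) (size h + size t) = size h by lia.
apply/eq_in_map => i; rewrite mem_iota add0n => /andP[_ ih].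
by rewrite takel_cat.
Qed.

Lemma labels_rcons (R : realType) (f : seq R -> nat) (h : seq R) (x : R) :
  labels f (rcons h x) = rcons (labels f h) (f (rcons h x)).
Proof.
apply: (@eq_from_nth _ 0%N) => [|i].
  by rewrite size_rcons !size_labels size_rcons.
rewrite size_labels size_rcons ltnS => ih.
rewrite nth_labels ?size_rcons // nth_rcons size_labels.
case: ltngtP ih => // [ih _|-> _].
  by rewrite nth_labels // -cats1 takel_cat.
by rewrite take_oversize // size_rcons.
Qed.

Lemma codom_run (R : realType) (A : online_algorithm R) (delta : R) (n : nat)
    (e s : n.-tuple R) :
  codom (run A delta e s) = labels (A delta e) s.
Proof.
rewrite /labels size_tuple -val_enum_ord -map_comp codomE.
exact: eq_map.
Qed.

Lemma size_undup_rcons (T : eqType) (s : seq T) (x : T) :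
  size (undup (rcons s x)) = ((x \notin s) + size (undup s))%N.
Proof.
have -> : size (undup (rcons s x)) = size (undup (x :: s)).
  by apply: perm_size; apply: perm_undup => y; rewrite mem_rcons.
by rewrite /=; case: (x \in s).
Qed.

Lemma leq_size_undup (T : eqType) (s : seq T) (d : nat) :
  (forall x, (count_mem x s <= d)%N) -> (size s <= d * size (undup s))%N.
Proof.
move=> sd; rewrite -(perm_size (perm_count_undup s)) size_flatten /shape.
rewrite -map_comp; elim: (undup s) => //= x t IH.
rewrite size_nseq mulnS; exact: leq_add.
Qed.

Lemma count_take_lt (T : Type) (P : pred T) (x0 : T) (s : seq T) (i j : nat) :
  (i < j <= size s)%N -> P (nth x0 s i) ->
  (count P (take i s) < count P (take j s))%N.
Proof.
move=> /andP[ij js] Pi.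
rewrite -[take j s](cat_take_drop i.+1) count_cat take_takel //.
rewrite (take_nth x0) ?(leq_trans ij) // -cats1 count_cat /= Pi.
lia.
Qed.

(** * Capacity of bins and upper bounds on [OPT] *)

Lemma packing_pair (R : realType) (n : nat) (T : eqType) (s : n.-tuple R)
    (p : 'I_n -> T) (i j : 'I_n) :
  (forall i, 0 <= tnth s i) -> is_packing s p -> i != j -> p i = p j ->
  tnth s i + tnth s j <= 1.
Proof.
move=> s0 /forallP /(_ i) sp ij pij; apply: le_trans sp.
rewrite (bigD1 i) //= (bigD1 j) /=; last by rewrite pij eqxx eq_sym.
by rewrite addrA lerDl sumr_ge0.
Qed.

Lemma packing_count (R : realType) (n : nat) (T : eqType) (s : n.-tuple R)
    (p : 'I_n -> T) (x : T) (d : nat) :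
  (forall i, d.+1%:R^-1 < tnth s i) -> is_packing s p ->
  (count_mem x (codom p) <= d)%N.
Proof.
move=> sd sp; have -> : count_mem x (codom p) = #|[pred i | p i == x]|.
  by rewrite codomE count_map -size_filter cardE enumT /enum_mem.
have [i /eqP pix|no] := pickP [pred i | p i == x]; last by rewrite eq_card0.
rewrite leqNgt; apply/negP => dlt.
have := forallP sp i; rewrite pix; apply/negP; rewrite -ltNge.
apply: (@le_lt_trans _ _ (\sum_(j < n | p j == x) d.+1%:R^-1)).
  by rewrite sumr_const -[leRHS]mulr_natl ler_pdivlMr ?ltr0n // mul1r ler_nat.
apply: ltr_sum => [|j _]; last exact: sd.
by apply/hasP; exists i; rewrite ?mem_index_enum ?pix.
Qed.

(** [OPT] minimizes over assignments into ['I_n], so the labels, being below [b <= n], are first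
    reread as ordinals. *)
Lemma OPT_le (R : realType) (n : nat) (s : n.-tuple R) (p : 'I_n -> nat)
    (b : nat) :
  (forall i, tnth s i <= 1) -> (b <= n)%N -> (forall i, (p i < b)%N) ->
  is_packing s p -> (OPT s <= b)%N.
Proof.
move=> s1 bn pb sp.
have pn i : (p i < n)%N by apply: leq_trans bn.
pose q := [ffun i => Ordinal (pn i)].
have qp : is_packing s q.
  apply/forallP => i; rewrite (eq_bigl (fun j => p j == p i)).
    exact: (forallP sp).
  by move=> j; rewrite !ffunE -val_eqE.
rewrite /OPT; case: arg_minnP => [|r rp rmin].
  apply/forallP => i; rewrite (big_pred1 i) // => j; by rewrite !ffunE.
apply: leq_trans (rmin _ qp) _.
rewrite /nbins -[b](size_iota 0) -(size_map val).
apply: uniq_leq_size; first by rewrite map_inj_uniq ?undup_uniq //; apply: val_inj.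
move=> y /mapP[z]; rewrite mem_undup => /codomP[i ->] ->.
by rewrite mem_iota ffunE /= add0n pb.
Qed.

(* Bin v has the two slots 2v and 2v+1. *)
Lemma packing_slots (R : realType) (n : nat) (s : n.-tuple R)
    (slot : 'I_n -> nat) :
  (forall i, tnth s i <= 1) -> injective slot ->
  (forall i j, slot j = (slot i).+1 -> ~~ odd (slot i) ->
     tnth s i + tnth s j <= 1) ->
  is_packing s (fun i => (slot i)./2).
Proof.
move=> s1 sI sp; apply/forallP => i; rewrite (bigD1 i) //=.
have [j /andP[pj ji]|no] := pickP (fun j => ((slot j)./2 == (slot i)./2) && (j != i)); last first.
  by rewrite big_pred0 ?addr0.
have sij : slot i != slot j by rewrite (inj_eq sI) eq_sym.
rewrite (bigD1 j) ?pj //= big_pred0 ?addr0 => [|k]; last first.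
  apply/negbTE/negP => /andP[/andP[pk ki] kj].
  have ski : slot k != slot i by rewrite (inj_eq sI).
  have skj : slot k != slot j by rewrite (inj_eq sI).
  move: pj pk sij ski skj; lia.
case: (ltngtP (slot i) (slot j)) sij => // sij _.
- by apply: sp; lia.
- by rewrite addrC; apply: sp; lia.
Qed.

(* With k = size h and a bins opened, the last clause says that the number k - a
   of joining items is m - k or m + 1 - k; each step raises k + (k - a) by 1 or
   2, so no value of m can be missed by more than 1. *)
Lemma adaptive_sizes (R : realType) (f : seq R -> nat) (lo hi : R) (m : nat) :
  lo < hi -> exists (h : seq R) (l u : R),
  [/\ lo <= l, l < u & u <= hi] /\
  [/\ forall x, x \in h -> lo <= x <= hi,
      forall x, x \in h -> ~~ (u <= x) -> x <= l,
      count (fun x => u <= x) h = size (undup (labels f h)),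
      forall v, v \in labels f h -> exists i,
        [/\ (i < size h)%N, u <= nth 0 h i & nth 0%N (labels f h) i = v] &
      (m + size (undup (labels f h)) <= 2 * size h
         <= m.+1 + size (undup (labels f h)))%N].
Proof.
move=> lohi; elim: m => [|m [h [l [u [[lol lu uhi] [hb hs hc hv hm]]]]]].
  by exists [::], lo, hi.
have [hm1|hm1] := leqP (m.+1 + size (undup (labels f h)))%N (2 * size h)%N.
  by exists h, l, u; split=> //; split=> //; lia.
pose x := (l + u) / 2%:R.
have lx : l < x by rewrite /x; lra.
have xu : x < u by rewrite /x; lra.
have hb' y : y \in rcons h x -> lo <= y <= hi.
  by rewrite mem_rcons inE => /predU1P[->|/hb //]; lra.
exists (rcons h x).
have old i : (i < size h)%N -> [/\ (i < size (rcons h x))%N,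
    nth 0 (rcons h x) i = nth 0 h i &
    nth 0%N (labels f (rcons h x)) i = nth 0%N (labels f h) i].
  move=> ih; rewrite labels_rcons !nth_rcons size_labels size_rcons ih.
  by split=> //; lia.
have [joined|opened] := boolP (f (rcons h x) \in labels f h).
- exists x, u; split; first by split=> //; lra.
  split=> //.
  + move=> y; rewrite mem_rcons inE => /predU1P[->//|yh] /(hs _ yh); lra.
  + rewrite labels_rcons size_undup_rcons joined -cats1 count_cat hc /=.
    by rewrite [u <= x]leNgt xu !addn0 add0n.
  + move=> v; rewrite labels_rcons mem_rcons inE => vl.
    have {}vl : v \in labels f h by case/predU1P: vl => [->|].
    have [i [ih ui iv]] := hv _ vl; have [? e1 e2] := old _ ih.
    by exists i; rewrite -labels_rcons e1 e2.
  + by rewrite labels_rcons size_undup_rcons joined size_rcons; lia.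
- exists l, x; split; first by split=> //; lra.
  split=> //.
  + move=> y; rewrite mem_rcons inE => /predU1P[->|yh]; first by rewrite lexx.
    by move=> xy; apply: hs => //; lra.
  + rewrite labels_rcons size_undup_rcons opened -cats1 count_cat /= lexx -hc.
    (* No size in [h] lies strictly between [l] and [u], so lowering the threshold from [u] to [x]
       leaves the count unchanged. *)
    rewrite addnC addn0; congr addn; apply: eq_in_count => y yh.
    have := hs _ yh; case: leP => [uy _|uy /(_ isT) yl]; lra.
  + move=> v; rewrite labels_rcons mem_rcons inE => /predU1P[->|vl].
      exists (size h); rewrite !nth_rcons size_labels size_rcons ltnn eqxx.
      by rewrite lexx.
    have [i [ih ui iv]] := hv _ vl; have [? e1 e2] := old _ ih.
    by exists i; rewrite -labels_rcons e1 e2; split=> //; lra.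
  + by rewrite labels_rcons size_undup_rcons opened size_rcons; lia.
Qed.

(** * The two-phase input: cost of the algorithm and of the optimum *)

Lemma run_pair (R : realType) (A : online_algorithm R) (delta : R) (n : nat)
    (e s : n.-tuple R) (i j : nat) :
  (forall x, x \in tval s -> 0 <= x) -> is_packing s (run A delta e s) ->
  (i < n)%N -> (j < n)%N -> i != j ->
  nth 0%N (labels (A delta e) s) i = nth 0%N (labels (A delta e) s) j ->
  nth 0 s i + nth 0 s j <= 1.
Proof.
move=> s0 sp ilt jlt ij; rewrite !nth_labels ?size_tuple // => rij.
rewrite -(tnth_nth 0 s (Ordinal ilt)) -(tnth_nth 0 s (Ordinal jlt)).
apply: (@packing_pair _ _ _ _ _ (Ordinal ilt) (Ordinal jlt) _ sp ij rij) => k; exact/s0/mem_tnth.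
Qed.

(** Each small item fits beside an item of size [1 - l], and there are enough of these; the other
    items of [h] are at most 1/2 and go in pairs into extra bins. *)
Lemma OPT_two_phases (R : realType) (n M : nat) (s : n.-tuple R) (h : seq R)
    (l u : R) :
  tval s = h ++ nseq M (1 - l) -> 0 <= l <= 1 ->
  (forall x, x \in h -> x <= 2%:R^-1) ->
  (forall x, x \in h -> ~~ (u <= x) -> x <= l) ->
  (count (fun x => ~~ (u <= x)%R) h <= M)%N ->
  (OPT s <= M + uphalf (count (fun x => (u <= x)%R) h))%N.
Proof.
move=> sE l01 h2 hs bM.
pose P := [pred x : R | u <= x].
(* [rank Q i] numbers the items satisfying [Q] from 0 in order of arrival. Those of size at least
   [u] take the slots from [2 * M] on. *)
pose rank (Q : pred R) i := count Q (take i h).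
(* Small items get the even slots of the first M bins, the items of size
   1 - l the odd ones. *)
pose slot i := if (i < size h)%N then
    if P (nth 0 h i) then (2 * M + rank P i)%N else (2 * rank (predC P) i)%N
  else (2 * (i - size h)).+1.
have nE : n = (size h + M)%N by rewrite -(size_tuple s) sE size_cat size_nseq.
have rank_lt (Q : pred R) i : (i < size h)%N -> Q (nth 0 h i) ->
    (rank Q i < count Q h)%N.
  move=> ih Qi; rewrite -[in X in (_ < X)%N](take_size h).
  by apply: count_take_lt Qi; rewrite ih leqnn.
have rank_inj (Q : pred R) i j : (i < size h)%N -> (j < size h)%N ->
    Q (nth 0 h i) -> Q (nth 0 h j) -> rank Q i = rank Q j -> i = j.
  move=> ih jh Qi Qj e; case: (ltngtP i j) => // ij.
    have : (rank Q i < rank Q j)%N by apply: count_take_lt Qi; rewrite ij ltnW.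
    by rewrite e ltnn.
  have : (rank Q j < rank Q i)%N by apply: count_take_lt Qj; rewrite ij ltnW.
  by rewrite e ltnn.
have slotP i : (i < n)%N ->
  [\/ [/\ (i < size h)%N, P (nth 0 h i), slot i = (2 * M + rank P i)%N &
          (rank P i < count P h)%N],
      [/\ (i < size h)%N, predC P (nth 0 h i), slot i = (2 * rank (predC P) i)%N &
          (rank (predC P) i < M)%N] |
      [/\ (size h <= i)%N, slot i = (2 * (i - size h)).+1 & (i - size h < M)%N]].
  rewrite /slot nE; case: (ltnP i (size h)) => ih iM; last by constructor 3; split=> //; lia.
  have [Pi|nPi] := ifPn; first by constructor 1; split=> //; exact: rank_lt.
  by constructor 2; split=> //; apply: leq_trans bM; apply: rank_lt.
have slot_inj : injective (fun i : 'I_n => slot i).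
  move=> i j /= e; apply: val_inj => /=; move: e.
  have [[i1 i2 -> i4]|[i1 i2 -> i3]|[i1 -> i3]] := slotP _ (ltn_ord i);
  have [[j1 j2 -> j4]|[j1 j2 -> j3]|[j1 -> j3]] := slotP _ (ltn_ord j) => e; try lia.
    by apply: (rank_inj P) => //; lia.
  by apply: (rank_inj (predC P)) => //; lia.
have nth_h (i : 'I_n) : (i < size h)%N -> tnth s i = nth 0 h i.
  by move=> ih; rewrite (tnth_nth 0) sE nth_cat ih.
have nth_M (i : 'I_n) : (size h <= i)%N -> tnth s i = 1 - l.
  move=> ih; rewrite (tnth_nth 0) sE nth_cat ltnNge ih /= nth_nseq.
  by have := ltn_ord i; rewrite {2}nE; case: ifP => //; lia.
have s1 i : tnth s i <= 1.
  case: (ltnP i (size h)) => ih; last by rewrite nth_M //; lra.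
  by rewrite nth_h //; have := h2 _ (mem_nth 0 ih); lra.
apply: (@OPT_le _ _ _ (fun i => (slot i)./2)) => //.
- rewrite -[count _ h]/(count P h); have := count_size P h; have := nE; lia.
- move=> i; rewrite -[count _ h]/(count P h).
  by have [[_ _ -> ?]|[_ _ -> ?]|[_ -> ?]] := slotP _ (ltn_ord i); lia.
- apply: packing_slots => // i j.
  (* Parity and range of the slots leave only two kinds of bin mates: two items of size at least
     [u], or a small item followed by one of size [1 - l]. *)
  have [[i1 i2 -> i4]|[i1 i2 -> i3]|[i1 -> i3]] := slotP _ (ltn_ord i);
  have [[j1 j2 -> j4]|[j1 j2 -> j3]|[j1 -> j3]] := slotP _ (ltn_ord j) => e o; try lia.
  + rewrite !nth_h //.
    by have := h2 _ (mem_nth 0 i1); have := h2 _ (mem_nth 0 j1); lra.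
  + rewrite nth_h // nth_M //.
    by have := hs _ (mem_nth 0 i1) i2; lra.
Qed.

(** The last bound makes the cost grow with [m], so that no additive constant can hide the ratio
    4/3. *)
Lemma bad_input (R : realType) (A : online_algorithm R) (delta : R) (m : nat) :
  0 < delta <= 1 -> respects_capacity A delta ->
  exists e s : m.+1.-tuple R,
    [/\ admissible delta e s,
        (4 * OPT s <= 3 * nbins (run A delta e s) + 3)%N &
        (m.+1 <= 2 * nbins (run A delta e s))%N].
Proof.
(* Length and estimates are fixed before any size, so [A delta e] is a single function of the
   history to play against. *)
move=> d01 Acap; pose e := nseq_tuple m.+1 (2%:R^-1 : R).
(* The range from [lo] to [1 - lo] is admissible for estimate 1/2, and [delta <= 1] gives
   [lo >= 3/8 > 1/3]. *)
pose lo := 2%:R^-1 - delta / 8%:R.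
have lohi : lo < 2%:R^-1 by rewrite /lo; lra.
have [h [l [u [[lol lu uhi] [hb hs hc hv hm]]]]] :=
  @adaptive_sizes R (A delta e) _ _ m lohi.
set a := size (undup _) in hc hm.
have ah : (a <= size h)%N by rewrite -hc count_size.
pose M := (m.+1 - size h)%N.
have size_s : size (h ++ nseq M (1 - l)) == m.+1.
  by rewrite size_cat size_nseq /M; lia.
pose s := Tuple size_s; exists e, s.
have sb x : x \in tval s -> lo <= x <= 1 - lo.
  by rewrite /= mem_cat => /orP[/hb|/nseqP[-> _]]; rewrite /lo in lol *; lra.
have adm : admissible delta e s.
  move=> i; have := sb _ (mem_tnth i s).
  rewrite (tnth_nth 0 e) nth_nseq ltn_ord le_min /lo.
  by move=> si; split; lra.
have sp := Acap _ _ _ adm.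
have s0 x : x \in tval s -> 0 <= x by move=> /sb; rewrite /lo; lra.
have [w wE wM] := labels_cat (A delta e) h (nseq M (1 - l)).
rewrite size_nseq in wM.
have sE : tval s = h ++ nseq M (1 - l) by [].
have nth1 i : (i < size h)%N -> nth 0 s i = nth 0 h i /\
    nth 0%N (labels (A delta e) s) i = nth 0%N (labels (A delta e) h) i.
  by move=> ih; rewrite sE wE !nth_cat size_labels ih.
have nth2 i : (i < M)%N -> nth 0 s (size h + i) = 1 - l /\
    nth 0%N (labels (A delta e) s) (size h + i) = nth 0%N w i.
  move=> iM; rewrite sE wE !nth_cat size_labels ltnNge leq_addr /= addKn.
  by rewrite nth_nseq iM.
have nb : nbins (run A delta e s) = (a + M)%N.
  rewrite /nbins codom_run wE undup_cat size_cat.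
  have uw : uniq w.
    apply/(uniqP 0%N) => i j; rewrite !inE wM => iM jM.
    have [ei1 ei2] := nth2 _ iM; have [ej1 ej2] := nth2 _ jM.
    rewrite -ei2 -ej2 => eij; apply/eqP/negPn/negP => ij.
    have := run_pair s0 sp _ _ _ eij.
    rewrite ei1 ej1 eqn_add2l => /(_ _ _ ij) H.
    have : 1 - l + (1 - l) <= 1 by apply: H; rewrite /M in iM jM; lia.
    lra.
  rewrite (undup_id uw) wM; congr addn.
  rewrite (_ : [seq x <- _ | _] = undup (labels (A delta e) h)) //.
  (* Every label of [h] belongs to a bin with an item of size at least [u], and
     [u + (1 - l) > 1]. *)
  apply/all_filterP/allP => v; rewrite mem_undup => /hv[i [ih ui iv]].
  apply/negP => /(nthP 0%N)[j]; rewrite wM => jM jv.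
  have [ei1 ei2] := nth1 _ ih; have [ej1 ej2] := nth2 _ jM.
  have eij : nth 0%N (labels (A delta e) s) i =
             nth 0%N (labels (A delta e) s) (size h + j) by rewrite ei2 ej2 iv jv.
  have := run_pair s0 sp _ _ _ eij.
  rewrite ei1 ej1 => H.
  have : nth 0 h i + (1 - l) <= 1 by apply: H; rewrite /M in jM; lia.
  lra.
(* All sizes exceed 1/3, so no bin receives three items. *)
have k2a : (size h <= 2 * a)%N.
  rewrite -(size_labels (A delta e) h); apply: leq_size_undup => v.
  apply: leq_trans (_ : count_mem v (codom (run A delta e s)) <= 2)%N.
    by rewrite codom_run wE count_cat leq_addr.
  apply: packing_count sp => i; have := sb _ (mem_tnth i s); rewrite /lo; lra.
have optb : (OPT s <= M + uphalf a)%N.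
  rewrite -hc; apply: (OPT_two_phases (l := l)) => //.
  - by rewrite /lo in lol; lra.
  - by move=> x /hb; lra.
  - have -> : count (fun x => ~~ (u <= x)) h = (size h - a)%N.
      by rewrite -hc -(count_predC (fun x => u <= x) h) addKn.
    by rewrite /M; lia.
rewrite nb; split=> //.
  (* Here [M <= size h - a + 1 <= a + 1] and [4 * uphalf a <= 2 * a + 2]; the two roundings add up
     to the constant 3. *)
  by rewrite /M in optb *; lia.
by rewrite /M; lia.
Qed.

Theorem theorem1 (R : realType) (delta : R) (hdelta : 0 < delta <= 1) :
  ~ exists A : online_algorithm R,
      respects_capacity A delta /\
      exists c : R, c < 4%:R / 3%:R /\ competitive A delta c.
Proof.
case=> A [Acap [c [c43 [K Acomp]]]].
(* Multiplying the bound on [OPT] by the ratio needs a nonnegative ratio, while [c] may be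
   negative. *)
pose d := Num.max c 0.
have d0 : 0 <= d by rewrite le_max lexx orbT.
have cd : c <= d by rewrite le_max lexx.
have d43 : d < 4%:R / 3%:R by rewrite gt_max c43; lra.
(* Eliminating [OPT] gives [(4 - 3 * d) * b <= 4 * K + 3 * d <= 4 * K + 4] for the cost [b]; the
   factor 2 comes from [m < 2 * b]. *)
pose X := 2%:R * (4%:R * K + 4%:R) / (4%:R - 3%:R * d).
have [e [s [adm opt big]]] := bad_input (Num.bound `|X|) hdelta Acap.
have := Acomp _ _ _ adm; set o := OPT s in opt *; set b := nbins _ in opt big *.
move=> ALG.
have {}ALG : b%:R <= d * o%:R + K.
  by apply: le_trans ALG _; rewrite lerD2r ler_wpM2r.
have {}opt : 4%:R * o%:R <= 3%:R * b%:R + 3%:R :> R.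
  by rewrite -!natrM -natrD ler_nat.
have {}big : X < 2%:R * b%:R.
  apply: le_lt_trans (ler_norm _) _.
  apply: lt_le_trans (archi_boundP (normr_ge0 X)) _.
  by rewrite -natrM ler_nat ltnW.
have : (4%:R - 3%:R * d) * b%:R <= 4%:R * K + 4%:R.
  have := ler_wpM2l d0 opt; lra.
rewrite leNgt => /negP; apply.
move: big; rewrite /X ltr_pdivrMr; last by lra.
lra.
Qed.
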